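(* Let $p\in(1,2)$. Then $M_p(r)=1$ for all $0\le r\le r_p$.
   Context: $\mathbb{D}=\{z\in\mathbb{C}:|z|<1\}$. $\mathcal{B}$ is the class of analytic functions $f(z)=\sum_{k=0}^\infty a_kz^k$ on $\mathbb{D}$ with $|f(z)|<1$ for all $z\in\mathbb{D}$. For $p>0$ and $f\in\mathcal{B}$, $M_p^f(r)=\sum_{k=0}^\infty |a_k|^p r^k$, and $M_p(r):=\sup_{f\in\mathcal{B}}M_p^f(r)$. The number $r_p$ is $$r_p:=\inf_{a\in[0,1)}\frac{1-a^p}{a^p(1-a^p)+(1-a^2)^p},$$ equivalently the supremum of those $r\in[0,1]$ such that $a^p+\frac{r(1-a^2)^p}{1-ra^p}\le 1$ for all $0\le a<1$. *)

(* Defs.v *)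
From HB Require Import structures.
From mathcomp Require Export all_boot all_order all_algebra.
From mathcomp Require Export all_classical all_reals all_analysis.
From mathcomp Require Export complex.

Set Implicit Arguments.
Unset Strict Implicit.
Unset Printing Implicit Defensive.

Import Order.TTheory GRing.Theory Num.Theory numFieldNormedType.Exports.
Import Normc.

Local Open Scope classical_set_scope.
Local Open Scope complex_scope.
Local Open Scope ring_scope.

Section BohrClass.
Context {R : realType}.

(* [R[i]^o], rather than [R[i]], carries the topology and the normed module
   structure given by the complex modulus. *)
Local Notation C := (R[i]^o).

Definition unit_disc : set C := [set z : C | `|z| < 1].

Definition analytic_on_disc (f : C -> C) : Prop :=
  forall z : C, unit_disc z -> derivable f z (1 : C).

Definition class_B : set (C -> C) :=
  [set f : C -> C | analytic_on_disc f /\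
                    forall z : C, unit_disc z -> `|f z| < 1].

(* [a] is the sequence of Taylor coefficients of [f] at 0; it is unique when it
   exists, and it exists for every function that is analytic on the disc. *)
Definition power_series_of (f : C -> C) (a : nat -> C) : Prop :=
  forall z : C, unit_disc z ->
    series (fun k => a k * z ^+ k : C) @ \oo --> f z.

Definition majorant (p : R) (a : nat -> C) (r : R) : \bar R :=
  (\sum_(0 <= k <oo) (normc (a k) `^ p * r ^+ k)%:E)%E.

Definition bohr_sup (p r : R) : \bar R :=
  ereal_sup [set m : \bar R | exists f : C -> C, exists a : nat -> C,
    [/\ class_B f, power_series_of f a & m = majorant p a r]].

Definition bohr_radius (p : R) : R :=
  inf [set (1 - a `^ p) / (a `^ p * (1 - a `^ p) + (1 - a ^+ 2) `^ p)
      | a in [set a : R | 0 <= a < 1]].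

End BohrClass.

(* Main.v *)
From mathcomp Require Import separable cyclotomic.
From mathcomp Require Import ring lra.
Require Import Defs.
Import Order.TTheory GRing.Theory Num.Theory numFieldNormedType.Exports.
Local Open Scope ring_scope.

Set Implicit Arguments.
Unset Strict Implicit.
Unset Printing Implicit Defensive.

(** The constants a < 1 have majorant a^p, which tends to 1 with a; so
    M_p(r) >= 1. For the upper bound write A = |a_0|. The crucial fact is an
    inequality between a weighted l2 norm of the Taylor coefficients and A:
      (sum_(k >= 1) |a_k|^2 rho^k) (1 - A^2 rho) <= rho (1 - A^2)^2
    for 0 <= rho <= 1 ([l2_coef_bound]), with equality for the disc
    automorphisms, whose coefficients satisfy |a_k| = (1 - A^2) A^(k-1).

    It follows from the Schwarz-Pick inequality
    |f - a_0| <= |z| |1 - a_0^* f|: put F = f - a_0, so that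
    1 - a_0^* f = (1 - A^2) - a_0^* F, and compare the mean squares of both sides
    on the circle of radius t = sqrt rho. As F has no constant term, Parseval gives
    ||F||^2 <= t^2 ((1 - A^2)^2 + A^2 ||F||^2), which is the claim.
    All of this is carried out for polynomials, where the mean over a circle is
    a finite average over roots of unity; the polynomials t S_N(t z), with S_N
    a partial sum of the series of f and t < 1, are bounded by 1 for N large,
    and t tends to 1 in the resulting inequality between polynomials in t.

    The passage from exponent 2 to exponent p replaces the Hoelder inequality by
    its pointwise form: u^(p/2) is concave, so x^p lies below its tangent in
    x^2 at any point y ([powR_le_tangent]). With y = m q^k this bounds
    sum |a_k|^p r^k by geometric sums and by the l2 sum at
    rho = r / q^(2-p) ([powR_sum_le]). Take m = (1 - q^2) / q, the choice that
    is exact for the automorphism with constant term q. If rho <= 1 at q = A,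
    the bound obtained is A^p + r (1 - A^2)^p / (1 - r A^p). Otherwise
    A < s, where s = r^(1/(2-p)) is the value of q with rho = 1, and the choice
    q = s, together with the tangent inequality for the term A^p as well, gives
    the same expression at s. The latter needs s^2 <= 1/2, which the
    definition of r_p yields at a = 1 / sqrt 2 ([bohr_ineq_root_bound]). In both
    cases the expression is at most 1 because r <= r_p. *)

(** * Mean squares over roots of unity *)

Lemma prim_root_exists (C : numClosedFieldType) n :
  (0 < n)%N -> exists z : C, n.-primitive_root z.
Proof.
move=> n_gt0; pose p : {poly C} := 'X^n - 1.
have [s Dp] := closed_field_poly_normal p.
rewrite (monicP _) ?monicXnsubC // scale1r in Dp.
have s1 : all n.-unity_root s by apply/allP=> z; rewrite -root_prod_XsubC -Dp.
have sz_s : (n < (size s).+1)%N.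
  by rewrite -(size_prod_XsubC s id) -Dp size_XnsubC.
have [|z] := hasP (cyclic.has_prim_root n_gt0 s1 _ sz_s); last by exists z.
by rewrite -separable_prod_XsubC -Dp separable_Xn_sub_1 // pnatr_eq0 -lt0n.
Qed.

Lemma norm_unity_root (C : numDomainType) n (z : C) :
  (0 < n)%N -> z ^+ n = 1 -> `|z| = 1.
Proof.
move=> n_gt0 zn; apply/eqP; rewrite -(pexpr_eq1 n_gt0) // -normrX zn.
by rewrite normr1.
Qed.

Lemma sum_unity_root (C : fieldType) n (w : C) :
  w ^+ n = 1 -> w != 1 -> \sum_(j < n) w ^+ j = 0.
Proof.
move=> wn w1; have := subrX1 w n; rewrite wn subrr => /esym/eqP.
by rewrite mulf_eq0 subr_eq0 (negPf w1) /= => /eqP.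
Qed.

(** Averaging over the n-th roots of unity is exact, not only asymptotic, as
    soon as the degree is below n: distinct exponents i, k < n are not congruent
    modulo n, so their cross term is a full sum over roots of unity. *)
Lemma parseval (C : numClosedFieldType) n (P : {poly C}) (z : C) :
  n.-primitive_root z -> (size P <= n)%N ->
  \sum_(j < n) `|P.[z ^+ j]| ^+ 2 = n%:R * \sum_(i < n) `|P`_i| ^+ 2.
Proof.
move=> zP szP; have n_gt0 := prim_order_gt0 zP; have zn := prim_expr_order zP.
have nz := norm_unity_root n_gt0 zn.
have z0 : z != 0 by rewrite -normr_eq0 nz oner_eq0.
have orth (i k : 'I_n) :
    \sum_(j < n) (z ^+ i * (z ^+ k)^* ) ^+ j = (i == k)%:R * n%:R.
  (* On the unit circle conjugation is inversion. *)
  have -> : (z ^+ k)^* = (z ^+ k)^-1.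
    apply: (mulfI (expf_neq0 k z0)).
    by rewrite divff ?expf_neq0 // -normCK normrX nz expr1n expr1n.
  have [->|neq_ik] := eqVneq i k.
    rewrite divff ?expf_neq0 //; under eq_bigr do rewrite expr1n.
    by rewrite sumr_const card_ord mul1r.
  rewrite mul0r; apply: sum_unity_root.
    by rewrite expr_div_n -!exprM mulnC [(k * n)%N]mulnC !exprM zn !expr1n divr1.
  apply: contra neq_ik => /eqP/divr1_eq/eqP.
  by rewrite (eq_prim_root_expr zP) !modn_small.
transitivity (\sum_(j < n) \sum_(i < n) \sum_(k < n)
    P`_i * (P`_k)^* * (z ^+ i * (z ^+ k)^* ) ^+ j).
  apply: eq_bigr => j _; rewrite normCK (horner_coef_wide _ szP) rmorph_sum /=.
  rewrite mulr_suml; apply: eq_bigr => i _; rewrite mulr_sumr.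
  apply: eq_bigr => k _; rewrite rmorphM /= mulrACA exprMn -!exprM.
  by rewrite -rmorphXn /= -!exprM [(j * i)%N]mulnC [(j * k)%N]mulnC.
rewrite exchange_big /= mulr_sumr; apply: eq_bigr => i _.
rewrite exchange_big /= (bigD1 i) //= -mulr_sumr orth eqxx mul1r normCK mulrC.
rewrite big1 ?addr0 // => k /negPf nki.
by rewrite -mulr_sumr orth eq_sym nki mul0r mulr0.
Qed.

Lemma l2_norm_le (C : numClosedFieldType) n (P Q : {poly C}) :
  (size P <= n)%N -> (size Q <= n)%N ->
  (forall z, `|z| = 1 -> `|P.[z]| <= `|Q.[z]|) ->
  \sum_(i < n) `|P`_i| ^+ 2 <= \sum_(i < n) `|Q`_i| ^+ 2.
Proof.
move=> szP szQ lePQ; have [->|n_gt0] := posnP n; first by rewrite !big_ord0.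
have [z zP] := prim_root_exists C n_gt0.
rewrite -(@ler_pM2l _ n%:R) ?ltr0n // -!(parseval zP) //.
apply: ler_sum => j _; rewrite lerXn2r ?nnegrE // lePQ // normrX.
by rewrite (norm_unity_root n_gt0 (prim_expr_order zP)) expr1n.
Qed.

Lemma cauchy_estimate (C : numClosedFieldType) (P : {poly C}) (M : C) :
  0 <= M -> (forall z, `|z| = 1 -> `|P.[z]| <= M) -> forall i, `|P`_i| <= M.
Proof.
move=> M0 leM i; pose n := maxn (size P) i.+1.
have lt_in : (i < n)%N by rewrite leq_maxr.
rewrite -(@ler_pXn2r _ 2) ?nnegrE //.
apply: (@le_trans _ _ (\sum_(j < n) `|P`_j| ^+ 2)).
  by rewrite (bigD1 (Ordinal lt_in)) //= lerDl sumr_ge0.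
apply: le_trans (_ : \sum_(j < n) `|(M%:P)`_j| ^+ 2 <= _).
  apply: l2_norm_le => [||z z1]; first by rewrite leq_maxl.
    by rewrite (leq_trans (size_polyC_leq1 _)) // (leq_trans _ lt_in).
  by rewrite hornerC (ger0_norm M0) leM.
case: n lt_in => // n _; rewrite big_ord_recl big1 ?addr0.
  by rewrite coefC eqxx ger0_norm.
by move=> k _; rewrite coefC /= normr0 expr0n.
Qed.

(** * The Schwarz-Pick inequality and the l2 bound for polynomials *)

Section UnitDiscPolynomials.
Variable R : realType.
Local Notation C := R[i].

(** The limit n -> oo, for inequalities between complex numbers in the partial
    order of C. *)
Lemma le0_of_le_geometric (x K u : C) : x \is Num.real ->
  0 <= u < 1 -> (forall n, x <= K * u ^+ n) -> x <= 0.
Proof.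
case/complex_realP=> y -> /andP[u0 u1] lex.
have /complex_realP[v Du] : u \is Num.real by rewrite ger0_real.
have v1 : `|v| < 1.
  by move: u0 u1; rewrite Du ler0c -[1]/(1%:C)%C ltcR => ? ?; rewrite ger0_norm.
have {}lex n : y <= complex.Re K * v ^+ n.
  have := lex n; rewrite Du -rmorphXn lecE => /andP[_]; case: (K) => a b /=.
  by rewrite mulr0 subr0.
rewrite -[0]/(0%:C)%C lecR.
apply: (ler_cvg_to (cvg_cst y) (cvg_geometric (complex.Re K) v1)).
by apply: nearW => n; exact: lex.
Qed.

(** Cauchy's estimates for P ^+ n give |P(z)|^n <= M^n / (1 - |z|); the
    constant disappears on taking n-th roots and letting n tend to infinity. *)
Lemma max_modulus_poly (P : {poly C}) (M : C) : 0 <= M ->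
  (forall z, `|z| = 1 -> `|P.[z]| <= M) -> forall z, `|z| <= 1 -> `|P.[z]| <= M.
Proof.
move=> M0 leM z; rewrite le_eqVlt => /predU1P[/leM//|z1].
rewrite real_leNgt ?ger0_real //; apply/negP => ltM.
have P0 : 0 < `|P.[z]| by apply: le_lt_trans ltM.
have z1' : 0 < 1 - `|z| by rewrite subr_gt0.
have : 1 <= 0 :> C; last by rewrite ler10.
apply: (@le0_of_le_geometric _ (1 - `|z|)^-1 (M / `|P.[z]|)); first exact: real1.
  by rewrite divr_ge0 // ltr_pdivrMr ?mul1r.
move=> n; rewrite expr_div_n mulrA ler_pdivlMr ?exprn_gt0 // mul1r.
rewrite -normrX -horner_exp horner_coef (le_trans (ler_norm_sum _ _ _)) //.
have leMn : forall i, `|(P ^+ n)`_i| <= M ^+ n.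
  apply: cauchy_estimate => [|w w1]; first by rewrite exprn_ge0.
  by rewrite horner_exp normrX lerXn2r ?nnegrE // leM.
apply: (@le_trans _ _ (\sum_(i < size (P ^+ n)) M ^+ n * `|z| ^+ i)).
  by apply: ler_sum => i _; rewrite normrM normrX ler_wpM2r ?exprn_ge0.
rewrite -mulr_sumr mulrC ler_wpM2r ?exprn_ge0 // -[leRHS]mul1r ler_pdivlMr //.
by rewrite -[1 - _]opprB mulrN mulrC -subrX1 opprB lerBlDr lerDl exprn_ge0.
Qed.

(** With w = a^* P, the Schwarz lemma applies to (P - a) / (1 - w), which is
    not a polynomial. Truncating the geometric series of 1 / (1 - w) makes it
    one: T n below is (P - a) (1 - w^n) / (1 - w) divided by z. On the circle
    it is at most 1 + |a|^n, since |P - a| <= |1 - w| wherever |P| <= 1, and the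
    maximum principle extends this to the disc; then n tends to infinity. *)
Lemma schwarz_pick_poly (P : {poly C}) : `|P`_0| < 1 ->
  (forall z, `|z| <= 1 -> `|P.[z]| <= 1) ->
  forall z, `|z| <= 1 -> `|P.[z] - P`_0| <= `|z| * `|1 - (P`_0)^* * P.[z]|.
Proof.
set a := P`_0 => a1 leP1.
have [Q DQ] : exists Q, P - a%:P = Q * 'X.
  exists (drop_poly 1 P); apply/polyP => -[|i].
    by rewrite coefB coefC coefMX subrr.
  by rewrite coefB coefC coefMX coef_drop_poly subr0 addn1.
have DPQ z : P.[z] - a = Q.[z] * z.
  by have := congr1 (horner^~ z) DQ; rewrite /= !hornerE.
pose w z := a^* * P.[z].
have lew z : `|z| <= 1 -> `|w z| <= `|a|.
  by move=> z1; rewrite normrM norm_conjC ler_piMr // leP1.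
have le_pick z : `|z| <= 1 -> `|P.[z] - a| <= `|1 - w z|.
  move=> /leP1 Pz1; rewrite -(@ler_pXn2r _ 2) ?nnegrE // !normCK.
  rewrite !rmorphB !rmorphM /= conjCK rmorph1 -subr_ge0.
  set b := P.[z] in Pz1 *.
  have -> : (1 - a^* * b) * (1 - a * b^* ) - (b - a) * (b^* - a^* ) =
     (1 - `|a| ^+ 2) * (1 - `|b| ^+ 2) by rewrite !normCK; ring.
  by rewrite mulr_ge0 // subr_ge0 expr_le1 // ltW.
pose T n := Q * \sum_(k < n) (a^*%:P * P) ^+ k.
have DT n z : (T n).[z] * (1 - w z) = Q.[z] * (1 - w z ^+ n).
  rewrite /T hornerM -mulrA; congr (_ * _).
  rewrite horner_sum mulrC -opprB mulNr.
  under eq_bigr do rewrite horner_exp hornerM hornerC.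
  by rewrite -subrX1 opprB.
have w_neq1 z : `|z| <= 1 -> 1 - w z != 0.
  move=> /lew lew1; rewrite subr_eq0; apply: contraTneq (le_lt_trans lew1 a1).
  by move=> <-; rewrite normr1 ltxx.
have leT n z : `|z| <= 1 -> `|(T n).[z]| <= 1 + `|a| ^+ n.
  apply: max_modulus_poly => [|{}z z1]; first by rewrite addr_ge0 ?exprn_ge0.
  have z1' : `|z| <= 1 by rewrite z1.
  have w0 : 0 < `|1 - w z| by rewrite normr_gt0 w_neq1.
  rewrite -(ler_pM2r w0) -normrM DT normrM mulrC.
  have -> : `|Q.[z]| = `|P.[z] - a| by rewrite DPQ normrM z1 mulr1.
  apply: ler_pM => //; last exact: le_pick.
  rewrite (le_trans (ler_normB _ _)) // normr1 lerD2l normrX.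
  by rewrite lerXn2r ?nnegrE // lew.
move=> z z1; rewrite -subr_le0 -/(w z).
set x := `|P.[z] - a|; set y := _ * _.
apply: (@le0_of_le_geometric _ (x + y) `|a|).
- by rewrite /y -normrM; apply: realB; apply: normr_real.
- by rewrite a1 andbT.
move=> n; rewrite lerBlDr mulrDl.
have : x * `|1 - w z ^+ n| <= y * (1 + `|a| ^+ n).
  rewrite /x DPQ -normrM mulrAC -DT -mulrA !normrM [in leRHS]/y mulrC.
  by rewrite [`|1 - _| * _]mulrC -2!mulrA !ler_wpM2l ?mulr_ge0 // leT.
have leX : 1 - `|a| ^+ n <= `|1 - w z ^+ n|.
  rewrite -[X in X - _](@normr1 C) (le_trans _ (lerB_dist _ _)) // lerB //.
  by rewrite normrX lerXn2r ?nnegrE // lew.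
have x0 : 0 <= x by exact: normr_ge0.
move/(le_trans (ler_wpM2l x0 leX)).
rewrite mulrBr mulrDr !mulr1 lerBlDr => /le_trans; apply.
by rewrite addrAC -addrA addrC.
Qed.

(** The parameter t is the radius of the circle; it enters through the dilated
    polynomials Q(t z), so that Parseval is used on the unit circle only. *)
Lemma l2_coef_bound_poly (P : {poly C}) (t : C) n : 0 <= t <= 1 ->
  `|P`_0| < 1 -> (forall z, `|z| <= 1 -> `|P.[z]| <= 1) ->
  (\sum_(i < n) `|P`_i.+1| ^+ 2 * (t ^+ 2) ^+ i.+1) * (1 - `|P`_0| ^+ 2 * t ^+ 2)
    <= t ^+ 2 * (1 - `|P`_0| ^+ 2) ^+ 2.
Proof.
set a := P`_0 => /andP[t0 t1] a1 leP1.
pose m := maxn (size P) n.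
pose S k := \sum_(i < k) `|P`_i.+1| ^+ 2 * (t ^+ 2) ^+ i.+1.
have S_ge0 i : 0 <= `|P`_i.+1| ^+ 2 * (t ^+ 2) ^+ i.+1.
  by rewrite mulr_ge0 ?exprn_ge0.
have at0 : 0 <= 1 - `|a| ^+ 2 * t ^+ 2.
  by rewrite subr_ge0 mulr_ile1 ?exprn_ge0 ?exprn_ile1 // ltW.
have leS : S n <= S m.
  rewrite /S -!(big_mkord xpredT (fun i => `|P`_i.+1| ^+ 2 * (t ^+ 2) ^+ i.+1)).
  rewrite (@big_cat_nat _ _ _ n 0%N m) /= ?leq_maxr // lerDl.
  by rewrite sumr_ge0.
apply: le_trans (ler_wpM2r at0 leS) _.
pose dil (Q : {poly C}) := \poly_(i < m.+1) (Q`_i * t ^+ i).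
have szP : (size P <= m.+1)%N by rewrite (leq_trans (leq_maxl _ _) (leqnSn _)).
have dilE (Q : {poly C}) z : (size Q <= m.+1)%N -> (dil Q).[z] = Q.[t * z].
  move=> szQ; rewrite horner_poly (horner_coef_wide _ szQ).
  by apply: eq_bigr => i _; rewrite exprMn mulrA.
pose F := P - a%:P; pose H := 1 - (a^* )%:P * P.
have szC (c : C) : (size c%:P <= m.+1)%N by exact: leq_trans (size_polyC_leq1 _) _.
have szF : (size F <= m.+1)%N.
  by rewrite (leq_trans (size_polyD _ _)) // geq_max szP size_polyN szC.
have szH : (size H <= m.+1)%N.
  rewrite (leq_trans (size_polyD _ _)) // geq_max -polyC1 szC size_polyN.
  by rewrite mul_polyC (leq_trans (size_scale_leq _ _)).
have sqn (c : C) i : `|c * t ^+ i| ^+ 2 = `|c| ^+ 2 * (t ^+ 2) ^+ i.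
  by rewrite normrM normrX (ger0_norm t0) exprMn -!exprM mulnC.
have F0 : `|(dil F)`_0| ^+ 2 = 0.
  by rewrite coef_poly coefB coefC subrr mul0r normr0 expr0n.
have FS (i : 'I_m) : `|(dil F)`_i.+1| ^+ 2 = `|P`_i.+1| ^+ 2 * (t ^+ 2) ^+ i.+1.
  by rewrite coef_poly ltnS ltn_ord coefB coefC subr0 sqn.
have H0 : `|(t *: dil H)`_0| ^+ 2 = t ^+ 2 * (1 - `|a| ^+ 2) ^+ 2.
  rewrite coefZ coef_poly /= mulr1 coefB coef1 coefCM [_^* * _]mulrC -normCK.
  rewrite normrM exprMn (ger0_norm t0) ger0_norm //.
  by rewrite subr_ge0 exprn_ile1 // ltW.
have HS (i : 'I_m) : `|(t *: dil H)`_i.+1| ^+ 2 =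
    t ^+ 2 * `|a| ^+ 2 * (`|P`_i.+1| ^+ 2 * (t ^+ 2) ^+ i.+1).
  rewrite coefZ coef_poly ltnS ltn_ord coefB coef1 coefCM sub0r.
  rewrite normrM exprMn (ger0_norm t0) sqn normrN normrM norm_conjC exprMn.
  by rewrite !mulrA.
have : \sum_(i < m.+1) `|(dil F)`_i| ^+ 2 <= \sum_(i < m.+1) `|(t *: dil H)`_i| ^+ 2.
  apply: l2_norm_le => [||z z1]; first exact: size_poly.
    by rewrite (leq_trans (size_scale_leq _ _)) ?size_poly.
  rewrite hornerZ !dilE // !hornerE.
  have tz : `|t * z| = t by rewrite normrM z1 mulr1 ger0_norm.
  rewrite normrM (ger0_norm t0) -[X in _ <= X * _]tz.
  by apply: schwarz_pick_poly => //; rewrite tz.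
rewrite !big_ord_recl F0 H0 add0r (eq_bigr _ (fun i _ => FS i)).
rewrite (eq_bigr _ (fun i _ => HS i)) -mulr_sumr -/(S m) => leFH.
by rewrite mulrBr mulr1 lerBlDr [S m * _]mulrC [`|a| ^+ 2 * _]mulrC.
Qed.

End UnitDiscPolynomials.

(** * The l2 bound for Taylor coefficients *)

Section TaylorCoefficients.
Variable R : realType.
Local Notation C := R[i].
Local Notation normc := (@Normc.normc R).

Lemma normr_normc (z : C) : `|z| = (normc z)%:C%C.
Proof. by case: z. Qed.

Lemma normc_ge0 (z : C) : 0 <= normc z.
Proof. by case: z => x y; exact: sqrtr_ge0. Qed.

Lemma geometric_tail_le (q : R) N M : 0 <= q < 1 -> (N <= M)%N ->
  \sum_(N <= k < M) q ^+ k <= q ^+ N / (1 - q).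
Proof.
case/andP=> q0 q1 leNM; rewrite ler_pdivlMr ?subr_gt0 // mulr_suml.
under eq_bigr do rewrite mulrBr mulr1 -exprSr -opprB.
by rewrite sumrN telescope_sumr // opprB lerBlDr lerDl exprn_ge0.
Qed.

Lemma horner1_ge0 (G : {poly R}) :
  (forall t, 0 < t < 1 -> 0 <= G.[t]) -> 0 <= G.[1].
Proof.
move=> G0; have Gcvg : (horner G t @[t --> (1 : R)^'-] --> G.[1])%classic.
  by apply: cvg_at_left_filter; exact: continuous_horner.
apply: (ler_cvg_to (cvg_cst 0) Gcvg).
near=> t; apply: G0; apply/andP; split; near: t.
  exact: nbhs_left_gt.
exact: nbhs_left_lt.
Unshelve. all: by end_near. Qed.

Lemma coef0_power_series (f : R[i]^o -> R[i]^o) (a : nat -> R[i]^o) :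
  power_series_of f a -> a 0%N = f 0.
Proof.
move=> /(_ 0) fa.
have d0 : unit_disc (0 : R[i]^o) by rewrite /unit_disc /= normr0.
apply/esym; apply: cvg_unique (fa d0) _; first exact: norm_hausdorff.
apply: cvg_near_cst.
near=> n; have n_gt0 : (0 < n)%N by near: n; exists 1%N.
rewrite /series /= -(prednK n_gt0) big_nat_recl //.
rewrite expr0 mulr1 big1 ?addr0 // => i _.
by rewrite exprS mul0r mulr0.
Unshelve. all: by end_near. Qed.

(** Uniformity in w: the coefficients are eventually below s^(-k) for some
    s in (t, 1), so on |w| <= t all partial sums of index at least N differ by
    less than the tail of a geometric series of ratio t / s; and for each
    single w some later partial sum is at most 1, as |f w| < 1. *)
Lemma partial_sum_le1D (f : R[i]^o -> R[i]^o) (a : nat -> R[i]^o) (t e : R) n :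
  class_B f -> power_series_of f a -> 0 < t < 1 -> 0 < e ->
  exists2 N, (n <= N)%N & forall w : C, `|w| <= t%:C%C ->
    `|\sum_(k < N) a k * w ^+ k| <= (1 + e)%:C%C.
Proof.
move=> [_ f1] fa /andP[t0 t1] e0.
pose s := (t + 1) / 2.
have [ts s1] : t < s /\ s < 1 by rewrite /s; split; lra.
have s0 : 0 < s by exact: lt_trans ts.
pose q := t / s.
have q0 : 0 <= q by rewrite divr_ge0 ?ltW.
have q1 : q < 1 by rewrite ltr_pdivrMr ?mul1r.
have ds : unit_disc (s%:C%C : R[i]^o).
  by rewrite /unit_disc /= ger0_norm ?ler0c ?ltW // -[1]/(1%:C)%C ltcR.
have := cvgP _ (fa _ ds) => /cvg_series_cvg_0 a0.
have near_a : (\forall k \near \oo, `|a k * s%:C%C ^+ k| < 1)%classic.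
  apply: filterS (cvgr_dist_lt _ _ a0 _ ltr01) => /= k.
  by rewrite sub0r normrN.
have near_q : (\forall N \near \oo, q ^+ N < e * (1 - q))%classic.
  apply: (@cvgr_lt R nat (\oo)%classic _ (GRing.exp q) 0).
    by apply: cvg_expr; rewrite ger0_norm.
  by rewrite mulr_gt0 // subr_gt0.
have [N0 _ leN0] := near_a.
have [N1 _ leN1] := near_q.
pose N := (n + N0 + N1)%N.
exists N; first by rewrite /N -addnA leq_addr.
move=> w wt.
have dw : unit_disc (w : R[i]^o).
  by rewrite /unit_disc /= (le_lt_trans wt) // -[1]/(1%:C)%C ltcR.
have near_f : (\forall M \near \oo, `|\sum_(k < M) a k * w ^+ k| <= 1)%classic.
  have fw : (0 : C) < 1 - `|f w| by rewrite subr_gt0 f1.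
  apply: filterS (cvgr_dist_lt _ _ (fa _ dw) _ fw) => /= M.
  rewrite distrC ltrBrDr -(big_mkord xpredT (fun k => a k * w ^+ k)) => /ltW.
  by apply: le_trans; rewrite -{1}[\sum_(0 <= k < M) _](subrK (f w)) ler_normD.
have [M0 _ leM0] := near_f.
pose M := (N + M0)%N.
have leNM : (N <= M)%N by rewrite leq_addr.
have := leM0 M (leq_addl _ _) => /= leM.
have tail : `|\sum_(N <= k < M) a k * w ^+ k| <= e%:C%C.
  apply: (@le_trans _ _ (\sum_(N <= k < M) q ^+ k)%:C%C).
    rewrite rmorph_sum /= (le_trans (ler_norm_sum _ _ _)) //.
    apply: ler_sum_nat => k /andP[Nk _].
    rewrite normrM normrX.
    apply: (@le_trans _ _ (`|a k| * t%:C%C ^+ k)).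
      by rewrite ler_wpM2l // lerXn2r ?nnegrE // ler0c ltW.
    have -> : t = s * q by rewrite /q mulrC divfK ?gt_eqF.
    rewrite rmorphM exprMn mulrA [leRHS]rmorphXn /= -[leRHS]mul1r.
    rewrite ler_wpM2r ?exprn_ge0 ?ler0c // ltW //.
    have := leN0 k; rewrite /= normrM normrX (ger0_norm (_ : 0 <= s%:C%C)) ?ler0c ?ltW //.
    by apply; rewrite (leq_trans _ Nk) // /N -addnA addnCA leq_addr.
  rewrite lecR (le_trans (geometric_tail_le _ leNM)) ?q0 //.
  rewrite ler_pdivrMr ?subr_gt0 // ltW //; apply: leN1.
  by rewrite /N /= leq_addl.
rewrite rmorphD rmorph1 /=.
move: leM; rewrite -!(big_mkord xpredT (fun k => a k * w ^+ k)).
rewrite (@big_cat_nat _ _ _ N) //= => leM.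
rewrite -[X in `|X|](addrK (\sum_(N <= k < M) a k * w ^+ k)).
by rewrite (le_trans (ler_normB _ _)) // lerD.
Qed.

Lemma normc_coef0_lt1 (f : R[i]^o -> R[i]^o) (a : nat -> R[i]^o) :
  class_B f -> power_series_of f a -> normc (a 0%N) < 1.
Proof.
move=> [_ f1] /coef0_power_series ->.
rewrite -ltcR -normr_normc; apply: f1.
by rewrite /unit_disc /= normr0.
Qed.

Lemma l2_coef_bound (f : R[i]^o -> R[i]^o) (a : nat -> R[i]^o) (rho : R) n :
  class_B f -> power_series_of f a -> 0 <= rho <= 1 ->
  (\sum_(i < n) normc (a i.+1) ^+ 2 * rho ^+ i.+1) *
      (1 - normc (a 0%N) ^+ 2 * rho)
    <= rho * (1 - normc (a 0%N) ^+ 2) ^+ 2.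
Proof.
(* G.[t] is the gap in the inequality for the polynomial t S_N(t z). *)
move=> fB fa /andP[rho0 rho1]; pose c k := normc (a k).
have c01 : c 0%N < 1 := normc_coef0_lt1 fB fa.
pose G : {poly R} := rho *: (1%:P - (c 0%N ^+ 2) *: 'X^2) ^+ 2 -
  (\sum_(i < n) (c i.+1 ^+ 2 * rho ^+ i.+1) *: ('X^(i.+2)) ^+ 2) *
    (1%:P - (c 0%N ^+ 2 * rho) *: 'X^2).
have GE t : G.[t] = rho * (1 - (c 0%N * t) ^+ 2) ^+ 2 -
    (\sum_(i < n) (c i.+1 * t ^+ i.+2) ^+ 2 * rho ^+ i.+1) *
      (1 - (c 0%N * t) ^+ 2 * rho).
  rewrite /G hornerD hornerN hornerZ horner_exp hornerM !hornerD !hornerN.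
  rewrite !hornerZ !hornerC !hornerXn horner_sum exprMn [_ * rho * _]mulrAC.
  congr (_ - _ * _); apply: eq_bigr => i _.
  by rewrite hornerZ horner_exp hornerXn [(c _ * _) ^+ 2]exprMn mulrAC.
suff : 0 <= G.[1].
  rewrite GE subr_ge0 mulr1; under eq_bigr do rewrite expr1n mulr1.
  exact.
apply: horner1_ge0 => t t01; have /andP[t0 t1] := t01.
(* 1 + (t^-1 - 1) = t^-1 is what the outer factor t of P compensates. *)
have [|N leN bound] := @partial_sum_le1D f a t (t^-1 - 1) n.+1 fB fa t01.
  by rewrite subr_gt0 invf_gt1.
pose P : {poly C} := \poly_(k < N) (t%:C%C * (a k * t%:C%C ^+ k)).
have PE z : P.[z] = t%:C%C * \sum_(k < N) a k * (t%:C%C * z) ^+ k.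
  rewrite horner_poly mulr_sumr; apply: eq_bigr => k _.
  by rewrite exprMn !mulrA.
have tC0 : (0 : C) <= t%:C%C by rewrite ler0c ltW.
have Pc k : (k < N)%N -> `|P`_k| = (c k * t ^+ k.+1)%:C%C.
  move=> kN; rewrite coef_poly kN !normrM normrX (ger0_norm tC0) normr_normc.
  by rewrite exprS -rmorphXn -!rmorphM /= mulrCA.
have P0 : `|P`_0| = (c 0%N * t)%:C%C by rewrite Pc ?(leq_trans _ leN) // expr1.
have c0t : c 0%N * t < 1.
  by rewrite (le_lt_trans _ c01) // ler_piMr ?normc_ge0 ?ltW.
have leP z : `|z| <= 1 -> `|P.[z]| <= 1.
  move=> z1; rewrite PE normrM (ger0_norm tC0).
  have tz : `|t%:C%C * z| <= t%:C%C by rewrite normrM (ger0_norm tC0) ler_piMr.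
  apply: le_trans (ler_wpM2l tC0 (bound _ tz)) _.
  by rewrite addrC subrK -rmorphM /= divff ?gt_eqF.
have := @l2_coef_bound_poly R P (Num.sqrt rho)%:C%C n.
rewrite -rmorphXn /= sqr_sqrtr // P0 => lePn; rewrite GE subr_ge0.
have {}lePn := lePn _ _ leP; move: lePn.
have -> : \sum_(i < n) `|P`_i.+1| ^+ 2 * rho%:C%C ^+ i.+1 =
    (\sum_(i < n) (c i.+1 * t ^+ i.+2) ^+ 2 * rho ^+ i.+1)%:C%C.
  rewrite rmorph_sum; apply: eq_bigr => i _.
  by rewrite Pc ?(leq_ltn_trans (ltn_ord i)) // -!rmorphXn -rmorphM.
rewrite -(rmorph1 (real_complex R)) -!rmorphXn /= -!rmorphM /= -!rmorphB /= -!rmorphXn /=.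
rewrite -!rmorphM !lecR ltcR => /(_ _ c0t); apply.
by rewrite sqrtr_ge0 -[X in _ <= X]sqrtr1 ler_wsqrtr.
Qed.

End TaylorCoefficients.

(** * From exponent 2 to exponent p *)

Section PowerSums.
Variable R : realType.
Implicit Types p q r x y b m rho : R.

Lemma powR_le1 p x : 0 <= p -> 0 <= x <= 1 -> x `^ p <= 1.
Proof.
move=> p0 /andP[x0 x1]; have p1E : 1 `^ p = 1 :> R by rewrite powR1.
by rewrite -[leRHS]p1E ge0_ler_powR ?nnegrE.
Qed.

Lemma powRX x p k : 0 <= x -> (x ^+ k) `^ p = (x `^ p) ^+ k.
Proof.
by move=> x0; rewrite -!powR_mulrn ?powR_ge0 // -!powRrM mulrC.
Qed.

Lemma powR_2B x p : 0 < x -> x `^ (2 - p) = x ^+ 2 / x `^ p.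
Proof.
by move=> x0; rewrite powRB ?(gt_eqF x0) ?implybT // powR_mulrn ?ltW.
Qed.

(** The right-hand side is the tangent at y^2 of the concave function
    u |-> u^(p/2), evaluated at u = x^2. *)
Lemma powR_le_tangent p x y : 0 < p < 2 -> 0 <= x -> 0 < y ->
  x `^ p <= y `^ p + p / 2 * ((x ^+ 2 - y ^+ 2) / y `^ (2 - p)).
Proof.
move=> /andP[p0 p2] x0 y0; pose u := x / y.
have u0 : 0 <= u by rewrite divr_ge0 // ltW.
have yp : 0 < y `^ p by exact: powR_gt0.
have le_u : u `^ p <= u ^+ 2 * (p / 2) + (1 - p / 2).
  have p20 : 0 < 1 - p / 2 by lra.
  have u2 : (u `^ p) `^ (2 / p) = u ^+ 2.
    by rewrite -powRrM mulrC divfK ?gt_eqF // powR_mulrn.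
  (* Young's inequality for (u^p) * 1 with exponents 2/p and 2/(2-p). *)
  have := @conjugate_powR _ (u `^ p) 1 (2 / p) (1 - p / 2)^-1.
  rewrite mulr1 u2 powR1 !invrK mul1r invf_div; apply.
  - exact: powR_ge0.
  - exact: ler01.
  - by rewrite divr_gt0.
  - by rewrite invr_gt0.
  - by rewrite addrC subrK.
have Dx : x = u * y by rewrite divfK ?gt_eqF.
rewrite powR_2B // Dx powRM ?(ltW y0) // exprMn.
have -> : y `^ p + p / 2 * ((u ^+ 2 * y ^+ 2 - y ^+ 2) / (y ^+ 2 / y `^ p)) =
    (u ^+ 2 * (p / 2) + (1 - p / 2)) * y `^ p.
  by field; rewrite !gt_eqF.
by rewrite ler_pM2r.
Qed.

(** The tangent is taken at y = m q^k in the k-th term, so that both y^p r^k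
    and the weight y^(p-2) r^k of c_k^2 are geometric in k. *)
Lemma powR_sum_le p r q m (c : nat -> R) n : 0 < p < 2 -> 0 <= r -> 0 < q ->
  0 < m -> (forall k, 0 <= c k) -> r * q `^ p < 1 ->
  \sum_(i < n) c i.+1 `^ p * r ^+ i.+1 <=
    (1 - p / 2) * m `^ p * (r * q `^ p / (1 - r * q `^ p)) +
    p / 2 / m `^ (2 - p) *
      \sum_(i < n) c i.+1 ^+ 2 * (r / q `^ (2 - p)) ^+ i.+1.
Proof.
move=> p02 r0 q0 m0 c0 x1; have /andP[p0 p2] := p02.
set x := r * q `^ p; set rho := r / _.
have x0 : 0 <= x by rewrite mulr_ge0 ?powR_ge0.
apply: (@le_trans _ _ ((1 - p / 2) * m `^ p * (\sum_(i < n) x ^+ i.+1) +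
    p / 2 / m `^ (2 - p) * \sum_(i < n) c i.+1 ^+ 2 * rho ^+ i.+1)).
  rewrite !mulr_sumr -big_split /=; apply: ler_sum => i _; set k := i.+1.
  have qk : 0 < q ^+ k by exact: exprn_gt0.
  have := powR_le_tangent p02 (c0 k) (mulr_gt0 m0 qk).
  move/(ler_wpM2r (exprn_ge0 k r0))/le_trans; apply.
  rewrite !powRM ?(ltW m0) ?(ltW qk) // !powRX ?(ltW q0) //.
  rewrite le_eqVlt; apply/orP; left; apply/eqP.
  rewrite /x /rho !exprMn exprVn !powR_2B // !expr_div_n.
  have qp : (q `^ p) ^+ k != 0 by rewrite expf_neq0 ?gt_eqF ?powR_gt0.
  have mp : m `^ p != 0 by rewrite gt_eqF ?powR_gt0.
  have q2 : (q ^+ 2) ^+ k = (q ^+ k) ^+ 2 by rewrite -!exprM mulnC.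
  rewrite q2; field.
  by rewrite (gt_eqF qk) (gt_eqF m0) qp mp.
rewrite lerD2r ler_wpM2l //.
  by rewrite mulr_ge0 ?powR_ge0 //; lra.
rewrite ler_pdivlMr ?subr_gt0 //.
under eq_bigr do rewrite exprS.
rewrite -mulr_sumr -mulrA ler_piMr // mulrC -[1 - _]opprB mulNr -subrX1 opprB.
by rewrite lerBlDr lerDl exprn_ge0.
Qed.

(** At b = 1 / sqrt 2 one has b^2 = 1 - b^2, and the hypothesis reduces to
    r u <= 1 - u with u = b^p >= 1/2; hence r <= b^2 / u = b^(2-p). *)
Lemma bohr_ineq_root_bound p r : 1 < p < 2 -> 0 < r ->
  (forall b, 0 <= b < 1 ->
    r * ((1 - b ^+ 2) `^ p + b `^ p * (1 - b `^ p)) <= 1 - b `^ p) ->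
  2 * (r `^ (2 - p)^-1) ^+ 2 <= 1.
Proof.
move=> /andP[p1 p2] r0 bohr; pose b : R := Num.sqrt 2^-1.
have b2 : b ^+ 2 = 2^-1 by rewrite sqr_sqrtr ?invr_ge0.
have b0 : 0 < b by rewrite sqrtr_gt0 invr_gt0.
have b1 : b < 1 by rewrite -(@ltr_pXn2r _ 2) ?nnegrE ?ltW // b2 expr1n; lra.
set u := b `^ p.
have u0 : 0 < u by exact: powR_gt0.
have u_ge : 2^-1 <= u.
  rewrite -b2 -powR_mulrn ?(ltW b0) // ger_powR ?b0 ?ltW //.
have half_p : (1 - b ^+ 2) `^ p = u ^+ 2.
  have -> : 1 - b ^+ 2 = b ^+ 2 by rewrite b2; lra.
  by rewrite powRX ?ltW.
have ru : r * u <= 2^-1.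
  have := bohr b; rewrite ltW // b1 half_p -/u => /(_ isT) leu; nra.
have le_rb : r <= b `^ (2 - p).
  by rewrite powR_2B // -/u b2 ler_pdivlMr.
have p2' : 0 < 2 - p by rewrite subr_gt0.
have : r `^ (2 - p)^-1 <= b.
  have e1 : (2 - p) * (2 - p)^-1 = 1 by rewrite divff ?gt_eqF.
  rewrite -[leRHS]powRr1 ?(ltW b0) // -[X in b `^ X]e1 powRrM.
  by rewrite ge0_ler_powR ?nnegrE ?powR_ge0 ?invr_ge0 // ltW.
have := powR_ge0 r (2 - p)^-1; set s := _ `^ _ => s0 sb.
have : s ^+ 2 <= b ^+ 2 by rewrite lerXn2r ?nnegrE // ltW.
by rewrite b2; lra.
Qed.

(** Here q = max (c 0) s treats the two cases of the argument together: the
    hypothesis on r is used at b = q, and rho = r / q^(2-p) <= 1 because q >= s. *)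
Lemma powR_sum_le1 p r (c : nat -> R) n : 1 < p < 2 -> 0 <= r ->
  (forall b, 0 <= b < 1 ->
    r * ((1 - b ^+ 2) `^ p + b `^ p * (1 - b `^ p)) <= 1 - b `^ p) ->
  (forall k, 0 <= c k) -> c 0%N < 1 ->
  (forall rho (N : nat), 0 <= rho <= 1 ->
    (\sum_(i < N) c i.+1 ^+ 2 * rho ^+ i.+1) * (1 - c 0%N ^+ 2 * rho)
      <= rho * (1 - c 0%N ^+ 2) ^+ 2) ->
  \sum_(k < n) c k `^ p * r ^+ k <= 1.
Proof.
move=> p12 r0 bohr c0 c1 l2; have /andP[p1 p2] := p12.
have p0 : 0 < p by lra.
case: n => [|n]; first by rewrite big_ord0.
rewrite big_ord_recl expr0 mulr1.
have c0p : c 0%N `^ p <= 1 by rewrite powR_le1 ?c0 ?ltW.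
move: r0; rewrite le_eqVlt => /predU1P[r0|r0].
  by rewrite -r0 big1 ?addr0 // => i _; rewrite exprS mul0r mulr0.
have e0 : 0 < 2 - p by lra.
pose s := r `^ (2 - p)^-1.
have s0 : 0 < s by exact: powR_gt0.
have s2 : 2 * s ^+ 2 <= 1 by exact: bohr_ineq_root_bound.
have s1 : s < 1 by nra.
have Dr : r = s `^ (2 - p).
  by rewrite -powRrM mulVf ?gt_eqF // powRr1 ?ltW.
pose q := Num.max (c 0%N) s; pose m := (1 - q ^+ 2) / q.
have q0 : 0 < q by rewrite lt_max s0 orbT.
have q1 : q < 1 by rewrite gt_max c1.
have q21 : 0 < 1 - q ^+ 2 by rewrite subr_gt0 exprn_ilt1 ?ltW.
have m0 : 0 < m by rewrite divr_gt0.
have qe0 : 0 < q `^ (2 - p) by exact: powR_gt0.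
pose rho := r / q `^ (2 - p); pose x := r * q `^ p.
have rho0 : 0 <= rho by rewrite divr_ge0 ?ltW.
have rho1 : rho <= 1.
  rewrite ler_pdivrMr // mul1r Dr ge0_ler_powR ?nnegrE ?(ltW s0) ?(ltW q0) //.
    exact: ltW.
  by rewrite le_max lexx orbT.
have Dx : x = rho * q ^+ 2.
  by rewrite /x /rho powR_2B //; field; rewrite !gt_eqF ?powR_gt0.
have x0 : 0 <= x by rewrite Dx mulr_ge0 ?exprn_ge0 ?(ltW q0).
have x1 : x < 1.
  have : q ^+ 2 < 1 by rewrite -subr_gt0.
  rewrite Dx; nra.
have p02 : 0 < p < 2 by rewrite p0.
have := powR_sum_le n p02 (ltW r0) q0 m0 c0 x1.
rewrite -/x -/rho; set T := \sum_(i < n) c i.+1 ^+ 2 * _.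
set S := (X in X <= _) => leS; change (c 0%N `^ p + S <= 1).
set me := m `^ (2 - p) in leS; have me0 : 0 < me by exact: powR_gt0.
have Dm : m `^ p = m ^+ 2 / me.
  by rewrite /me powR_2B //; field; rewrite !gt_eqF ?powR_gt0.
pose y := x / (1 - x).
have key : c 0%N `^ p + p / 2 / me * T <= q `^ p + p / 2 / me * (m ^+ 2 * y).
  have hT := l2 rho n; rewrite rho0 rho1 -/T in hT; move/(_ isT): hT => hT.
  have pme : 0 < p / 2 / me by rewrite !divr_gt0.
  (* For q = c 0 this is the l2 bound. For q = s > c 0, rho = 1, and lowering
     c 0 from s costs more in c 0 ^ p than T can gain, since s <= m. *)
  have [sc|cs] := lerP s (c 0%N).
    have Dq : c 0%N = q by rewrite /q max_l.
    rewrite Dq lerD2l ler_pM2l // -(@ler_pM2r _ (1 - x)) ?subr_gt0 //.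
    have -> : m ^+ 2 * y * (1 - x) = rho * (1 - q ^+ 2) ^+ 2.
      by rewrite /m /y Dx; field; rewrite (gt_eqF q0) -Dx gt_eqF ?subr_gt0.
    by move: hT; rewrite Dq mulrC [q ^+ 2 * _]mulrC -Dx mulrC.
  have Dq : q = s by rewrite /q max_r // ltW.
  have Drho : rho = 1 by rewrite /rho Dq -Dr divff ?gt_eqF.
  have c2 : 0 < 1 - c 0%N ^+ 2 by rewrite subr_gt0 exprn_ilt1.
  have Dmy : m ^+ 2 * y = 1 - s ^+ 2.
    rewrite /m /y Dx Drho Dq !mul1r; field.
    by rewrite (gt_eqF s0) -Dq gt_eqF.
  have T_le : T <= 1 - c 0%N ^+ 2.
    by move: hT; rewrite Drho mulr1 mul1r expr2 ler_pM2r.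
  have sm : s `^ (2 - p) <= me.
    rewrite ge0_ler_powR ?nnegrE ?(ltW s0) ?(ltW m0) ?(ltW e0) //.
    by rewrite /m Dq ler_pdivlMr //; lra.
  have tan : c 0%N `^ p <= s `^ p + p / 2 * ((c 0%N ^+ 2 - s ^+ 2) / me).
    apply: le_trans (powR_le_tangent p02 (c0 _) s0) _.
    rewrite lerD2l ler_pM2l ?divr_gt0 // ler_wnM2l //.
      by rewrite subr_le0 lerXn2r ?nnegrE // ltW.
    by rewrite lef_pV2 ?posrE // powR_gt0.
  rewrite Dmy Dq; apply: le_trans (lerD tan (ler_wpM2l (ltW pme) T_le)) _.
  by rewrite le_eqVlt; apply/orP; left; apply/eqP; field; rewrite gt_eqF.
have : q `^ p + m `^ p * y <= 1.
  have mq : m `^ p * q `^ p = (1 - q ^+ 2) `^ p.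
    by rewrite -powRM ?(ltW m0) ?(ltW q0) // divfK ?gt_eqF.
  have := bohr q; rewrite (ltW q0) q1 => /(_ isT); rewrite -mq => le1.
  rewrite -lerBrDl mulrA ler_pdivrMr ?subr_gt0 // /x.
  by lra.
move: leS key; rewrite -/y Dm.
have -> : (1 - p / 2) * (m ^+ 2 / me) * y = m ^+ 2 / me * y - p / 2 / me * (m ^+ 2 * y).
  by field; rewrite gt_eqF.
lra.
Qed.

End PowerSums.

(** * The Bohr radius *)

Section BohrRadius.
Variable R : realType.
Implicit Types p r b x : R.

Lemma le_bohr_radius_ineq p r b : 0 < p -> r <= bohr_radius p -> 0 <= b < 1 ->
  r * ((1 - b ^+ 2) `^ p + b `^ p * (1 - b `^ p)) <= 1 - b `^ p.
Proof.
move=> p0 ler b01.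
have bp1 a : 0 <= a < 1 -> 0 <= 1 - a `^ p :> R.
  by move=> /andP[a0 a1]; rewrite subr_ge0 powR_le1 ?a0 ?ltW.
have /andP[b0 b1] := b01.
have den0 : 0 < b `^ p * (1 - b `^ p) + (1 - b ^+ 2) `^ p.
  rewrite ltr_wpDl ?mulr_ge0 ?powR_ge0 ?bp1 // powR_gt0 //.
  by rewrite subr_gt0 exprn_ilt1.
rewrite addrC -ler_pdivlMr //; apply: le_trans ler _; apply: ge_inf.
  exists 0 => _ [a /= a01 <-].
  by rewrite divr_ge0 ?bp1 // addr_ge0 ?mulr_ge0 ?powR_ge0 ?bp1.
by exists b.
Qed.

Lemma majorant_le1 p r (f : R[i]^o -> R[i]^o) (a : nat -> R[i]^o) :
  1 < p < 2 -> 0 <= r <= bohr_radius p -> class_B f -> power_series_of f a ->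
  (majorant p a r <= 1)%E.
Proof.
move=> p12 /andP[r0 rp] fB fa; have /andP[p1 p2] := p12.
apply: lime_le.
  apply: is_cvg_nneseries => k _ _.
  by rewrite lee_fin mulr_ge0 ?powR_ge0 ?exprn_ge0.
apply: nearW => n; rewrite sumEFin lee_fin big_mkord.
apply: (@powR_sum_le1 R p r (fun k => Normc.normc (a k)) n p12 r0) => [b b01|k||rho N rho01].
- by apply: le_bohr_radius_ineq; rewrite // (lt_trans _ p1).
- exact: normc_ge0.
- exact: normc_coef0_lt1 fB fa.
- exact: l2_coef_bound fB fa rho01.
Qed.

(** The constant function x^(1/p) has majorant x. *)
Lemma le_bohr_sup_cst p r x : 0 < p -> 0 <= r -> 0 <= x < 1 ->
  (x%:E <= bohr_sup p r)%E.
Proof.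
move=> p0 r0 /andP[x0 x1].
pose b := x `^ p^-1.
have b0 : 0 <= b by exact: powR_ge0.
have bp : b `^ p = x by rewrite -powRrM mulVf ?gt_eqF // powRr1.
have b1 : b < 1.
  rewrite ltNge; apply: contraTN x1 => b1; rewrite -leNgt -bp.
  have p1E : 1 `^ p = 1 :> R by rewrite powR1.
  by rewrite -[leLHS]p1E ge0_ler_powR ?nnegrE // ltW.
pose f : R[i]^o -> R[i]^o := fun=> (b%:C)%C.
pose a : nat -> R[i]^o := fun k => if k is 0 then (b%:C)%C else 0.
have normc_b : Normc.normc (b%:C)%C = b.
  by rewrite /= expr0n addr0 sqrtr_sqr ger0_norm.
apply: le_ereal_sup_tmp; exists (majorant p a r).
  exists f, a; split=> //; first split.
  - by move=> z _; exact: derivable_cst.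
  - by move=> z _; rewrite /f normr_normc normc_b -[1]/(1%:C)%C ltcR.
  move=> z _; apply: cvg_near_cst; near=> n.
  have n_gt0 : (0 < n)%N by near: n; exists 1%N.
  rewrite /series /= -(prednK n_gt0) big_nat_recl // mulr1 big1 ?addr0 // => i _.
  by rewrite mul0r.
apply: le_trans (nneseries_lim_ge (P := xpredT) 1 _).
  by rewrite big_nat1 expr0 mulr1 normc_b bp.
by move=> k _ _; rewrite lee_fin mulr_ge0 ?powR_ge0 ?exprn_ge0.
Unshelve. all: by end_near. Qed.

End BohrRadius.

Theorem corollary1 (R : realType) (p : R) (hp : 1 < p < 2) :
  forall r : R, 0 <= r <= bohr_radius p -> bohr_sup p r = 1%E.
Proof.
move=> r hr; have /andP[r0 _] := hr; have /andP[p1 _] := hp.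
apply/eqP; rewrite eq_le; apply/andP; split.
  by apply/ereal_supP => _ [f [a [fB fa ->]]]; exact: majorant_le1 hr fB fa.
apply/lee_addgt0Pr => e e0.
have [e1|e1] := ltrP e 1; last first.
  rewrite (le_trans (_ : _ <= e%:E)%E) ?lee_fin //.
  by rewrite leeDr // (le_bohr_sup_cst (x := 0)) ?lexx ?ltr01 // (lt_trans _ p1).
rewrite -leeBlDr // -EFinB; apply: le_bohr_sup_cst => //.
  by rewrite (lt_trans _ p1).
by rewrite subr_ge0 (ltW e1) gtrBl.
Qed.
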